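(* Let $P$ be a probability measure on $\mathbb{R}^p$ that is absolutely continuous with respect to the Lebesgue measure, with density $f$. Then the following hold. (i) If $f$ is uniformly continuous and bounded, then $$\lim_{\tau\to 0^+}\sup_{x\in\mathbb{R}^p}|f_\tau(x)-f(x)|=0.$$ (ii) If $f$ is continuous, then for all compact sets $K\subset\mathbb{R}^p$ $$\lim_{\tau\to 0^+}\sup_{x\in K}|f_\tau(x)-f(x)|=0.$$ In particular, for all $x\in\mathbb{R}^p$, $$\lim_{\tau,\epsilon\to 0^+}\ \sup_{y\in\overline{B}_\epsilon(x)}|f_\tau(y)-f(x)|=0.$$
   Context: $p\ge 1$; $\|\cdot\|$ is the Euclidean norm on $\mathbb{R}^p$ and $\overline{B}_\epsilon(x)=\{y\in\mathbb{R}^p:\|x-y\|\le\epsilon\}$. For $x\in\mathbb{R}^p$ and $\tau\in[0,\infty]$, $$Z_\tau(x)=\{(x_1,x_2)\in\mathbb{R}^p\times\mathbb{R}^p:\ \max_{i=1,2}\|x-x_i\|\le\|x_1-x_2\|\le\tau\}.$$ The local lens depth of $x$ with respect to $P$ is $LLD(x,\tau)=\int_{\mathbb{R}^p\times\mathbb{R}^p}\mathbf{I}((x_1,x_2)\in Z_\tau(x))\,dP(x_1)\,dP(x_2)$. $\Lambda_1$ is the Lebesgue measure of $Z_1(0)$ in $\mathbb{R}^p\times\mathbb{R}^p$. For $0<\tau<\infty$ the $\tau$-approximation of $f$ is $$f_\tau(x)=\frac{1}{\tau^p\sqrt{\Lambda_1}}\sqrt{LLD(x,\tau)}.$$ *)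

(* Defs.v *)
From HB Require Import structures.
From mathcomp Require Import all_boot all_order all_algebra.
From mathcomp Require Import all_classical all_reals all_analysis.
From mathcomp Require Import measurable_realfun.

Set Implicit Arguments.
Unset Strict Implicit.
Unset Printing Implicit Defensive.

Import Order.TTheory GRing.Theory Num.Theory.
Import numFieldNormedType.Exports.

Local Open Scope classical_set_scope.
Local Open Scope ring_scope.

(* R^n is 'rV[R]_n. The library already gives it the topology and the uniform
   structure of R^n; it is equipped here with the sigma-algebra generated by the
   coordinates, which is the Borel one (see [measurable_rV_open]). *)
Section measurable_rV.
Context (R : realType) (n : nat).

Let coors : 'I_n -> 'rV[R]_n -> R := fun i x => x ord0 i.

Let rV_set0 : g_sigma_preimage coors set0.
Proof. exact: sigma_algebra0. Qed.

Let rV_setC A : g_sigma_preimage coors A -> g_sigma_preimage coors (~` A).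
Proof. exact: sigma_algebraC. Qed.

Let rV_bigcup (F : (set 'rV[R]_n)^nat) :
  (forall i, g_sigma_preimage coors (F i)) ->
  g_sigma_preimage coors (\bigcup_i (F i)).
Proof. exact: sigma_algebra_bigcup. Qed.

HB.instance Definition _ := @isMeasurable.Build default_measure_display
  'rV[R]_n (g_sigma_preimage coors) rV_set0 rV_setC rV_bigcup.

End measurable_rV.

Lemma measurable_coord (R : realType) n (i : 'I_n) :
  measurable_fun [set: 'rV[R]_n] (fun x => x ord0 i).
Proof.
move=> _ Y mY; rewrite setTI; apply: sub_sigma_algebra => /=.
rewrite -bigcup_seq/=; exists i => /=; first by rewrite mem_index_enum.
by exists Y => //; rewrite setTI.
Qed.

Lemma measurable_fun_coordP d (T : measurableType d) (R : realType) n
    (f : T -> 'rV[R]_n) :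
  measurable_fun [set: T] f <->
  forall i, measurable_fun [set: T] (fun x => f x ord0 i).
Proof.
split=> [mf i|mf].
  exact: (measurableT_comp (@measurable_coord R n i) mf).
move=> _ Y; rewrite setTI; move: Y.
have sA : sigma_algebra setT [set Y | measurable (f @^-1` Y)].
  split=> //=.
  - by rewrite preimage_set0.
  - by move=> A mA; rewrite setTD preimage_setC; exact: measurableC.
  - by move=> F mF; rewrite preimage_bigcup; exact: bigcupT_measurable.
apply: smallest_sub; first exact: sA.
rewrite -bigcup_seq => A [i _ [B mB <-]] /=; rewrite setTI.
by have := mf i measurableT B mB; rewrite setTI.
Qed.


Lemma open_measurable_rV (R : realType) n (U : set 'rV[R]_n) :
  open U -> measurable U.
Proof.
move=> oU.
pose B (qk : 'rV[rat]_n * nat) : set 'rV[R]_n :=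
  [set y | forall i, ball (ratr (qk.1 ord0 i) : R) qk.2.+1%:R^-1 (y ord0 i)].
have mB qk : measurable (B qk).
  have -> : B qk = \bigcap_(i in [set: 'I_n])
      ((fun y : 'rV[R]_n => y ord0 i) @^-1`
        ball (ratr (qk.1 ord0 i) : R) qk.2.+1%:R^-1).
    by apply/seteqP; split=> [y By i _|y By i]; [exact: By|exact: (By i I)].
  apply: fin_bigcap_measurable; first exact: finite_finset.
  move=> i _; rewrite -[X in measurable X]setTI.
  by apply: measurable_coord => //; exact: measurable_ball.
have -> : U = \bigcup_qk (if `[< B qk `<=` U >] then B qk else set0).
  apply/seteqP; split=> [x Ux|x [qk _]]; last first.
    by case: asboolP => // BU /BU.
  have /nbhs_ballP[e /= e0 eU] : nbhs x U by exact: open_nbhs_nbhs.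
  have e20 : 0 < e / 2 by rewrite divr_gt0.
  pose k := Num.truncn (e / 2)^-1.
  have ke : k.+1%:R^-1 < e / 2.
    by rewrite invf_plt ?posrE// truncnS_gt.
  have k0 : 0 < k.+1%:R^-1 :> R by rewrite invr_gt0.
  have /choice[q qP] : forall i, exists q : rat,
      ball (ratr q : R) k.+1%:R^-1 (x ord0 i).
    move=> i; have /rat_in_itvoo[q] :
        x ord0 i - k.+1%:R^-1 < x ord0 i + k.+1%:R^-1.
      by rewrite ltrBlDr -addrA ltrDl addr_gt0.
    rewrite in_itv/= => /andP[xq qx]; exists q.
    by rewrite ball_itv /= in_itv/= ltrBlDr qx -ltrBlDr xq.
  exists (\row_i q i, k) => //.
  case: asboolP => [_ i|]; first by rewrite mxE; exact: qP.
  case; move=> y By; apply: eU; split=> // i j; rewrite (ord1 i).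
  have := By j; rewrite /= mxE => qy.
  apply: (@le_ball _ _ _ (k.+1%:R^-1 + k.+1%:R^-1)).
    by rewrite [leRHS]splitr lerD// ltW.
  by apply: ball_triangle qy; exact/ball_sym/qP.
by apply: countable_bigcupT_measurable => // qk; case: asboolP.
Qed.

Lemma measurable_rV_open (R : realType) n :
  @measurable _ 'rV[R]_n = <<s [set U : set 'rV[R]_n | open U] >>.
Proof.
apply/seteqP; split; last first.
  apply: smallest_sub; first exact: sigma_algebra_measurable.
  exact: open_measurable_rV.
apply: smallest_sub; first exact: smallest_sigma_algebra.
rewrite -bigcup_seq => A [i _ [B mB <-]].
pose T := g_sigma_algebraType [set U : set 'rV[R]_n | open U].
suff : measurable_fun [set: T] (fun x : T => (x : 'rV[R]_n) ord0 i).
  by move=> /(_ measurableT B mB).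
apply: measurability; first exact: (RGenOpens.measurableE R).
move=> _ [_ [x [y ->]] <-]; rewrite setTI.
apply: sub_sigma_algebra; rewrite /=.
apply: open_comp; last exact: interval_open.
by move=> z _; exact: coord_continuous.
Qed.

Section lebesgue_measure_rV.
Context (R : realType).

Definition rV_cons n (xv : R * 'rV[R]_n) : 'rV[R]_n.+1 :=
  \row_i (if unlift ord0 i is Some j then xv.2 ord0 j else xv.1).

Definition rV_uncons n (v : 'rV[R]_n.+1) : R * 'rV[R]_n :=
  (v ord0 ord0, \row_j v ord0 (lift ord0 j)).

Lemma rV_consK n : cancel (@rV_cons n) (@rV_uncons n).
Proof.
move=> [x v]; rewrite /rV_uncons /rV_cons mxE unlift_none; congr pair.
by apply/rowP => j; rewrite !mxE liftK.
Qed.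

Lemma measurable_rV_cons n : measurable_fun [set: R * 'rV[R]_n] (@rV_cons n).
Proof.
apply/measurable_fun_coordP => i.
have [j ->|->] := unliftP ord0 i.
  rewrite (_ : (fun _ => _) = (fun v : 'rV[R]_n => v ord0 j) \o snd).
    exact: (measurableT_comp (@measurable_coord R n j) measurable_snd).
  by apply/funext => xv; rewrite /= mxE liftK.
rewrite (_ : (fun _ => _) = fst)//.
by apply/funext => xv; rewrite mxE unlift_none.
Qed.

Lemma measurable_rV_uncons n : measurable_fun [set: 'rV[R]_n.+1] (@rV_uncons n).
Proof.
apply: measurable_fun_pair; first exact: measurable_coord.
apply/measurable_fun_coordP => j.
rewrite (_ : (fun _ => _) = fun v : 'rV[R]_n.+1 => v ord0 (lift ord0 j)).
  exact: measurable_coord.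
by apply/funext => v; rewrite mxE.
Qed.

Section step.
Context n (m : {sigma_finite_measure set 'rV[R]_n -> \bar R}).

Definition lebesgue_rVS : set 'rV[R]_n.+1 -> \bar R :=
  pushforward (@lebesgue_measure R \x m)%E (@rV_cons n).

Let mcons_pre A : measurable A -> measurable (@rV_cons n @^-1` A).
Proof.
by move=> mA; rewrite -[X in measurable X]setTI; exact: measurable_rV_cons.
Qed.

Let lebesgue_rVS0 : lebesgue_rVS set0 = 0%E.
Proof. by rewrite /lebesgue_rVS /pushforward preimage_set0 measure0. Qed.

Let lebesgue_rVS_ge0 A : (0 <= lebesgue_rVS A)%E.
Proof. exact: (measure_ge0 (@lebesgue_measure R \x m)%E). Qed.

Let lebesgue_rVS_sigma_additive : semi_sigma_additive lebesgue_rVS.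
Proof.
move=> F mF tF mUF; rewrite /lebesgue_rVS /pushforward preimage_bigcup.
apply: (measure_semi_sigma_additive (s := (@lebesgue_measure R \x m)%E)).
- by move=> k; exact: mcons_pre.
- apply/trivIsetP => i j _ _ ij; rewrite -preimage_setI.
  by move/trivIsetP : tF => /(_ _ _ _ _ ij) ->//; rewrite preimage_set0.
- by rewrite -preimage_bigcup; exact: mcons_pre.
Qed.

HB.instance Definition _ := isMeasure.Build _ _ _ lebesgue_rVS
  lebesgue_rVS0 lebesgue_rVS_ge0 lebesgue_rVS_sigma_additive.

Let lebesgue_rVS_sigma_finite : sigma_finite setT lebesgue_rVS.
Proof.
have /sigma_finiteP[F [FT ndF Foo]] := sigma_finiteT (@lebesgue_measure R).
have /sigma_finiteP[G [GT ndG Goo]] := sigma_finiteT m.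
exists (fun k => @rV_uncons n @^-1` (F k `*` G k)).
  apply/esym; rewrite -subTset => v _.
  have [i _ Fi] : (\bigcup_i F i) (rV_uncons v).1 by rewrite -FT.
  have [j _ Gj] : (\bigcup_i G i) (rV_uncons v).2 by rewrite -GT.
  exists (maxn i j) => //; split.
  - by move: (rV_uncons v).1 Fi; exact/subsetPset/ndF/leq_maxl.
  - by move: (rV_uncons v).2 Gj; exact/subsetPset/ndG/leq_maxr.
move=> k; have [mF Fk] := Foo k; have [mG Gk] := Goo k; split.
  rewrite -[X in measurable X]setTI; apply: measurable_rV_uncons => //.
  exact: measurableX.
rewrite /lebesgue_rVS /pushforward -comp_preimage.
rewrite (_ : _ \o _ = id); last by apply/funext => xv /=; rewrite rV_consK.
by rewrite preimage_id product_measure1E// lte_mul_pinfty// ge0_fin_numE.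
Qed.

HB.instance Definition _ := Measure_isSigmaFinite.Build _ _ _ lebesgue_rVS
  lebesgue_rVS_sigma_finite.

End step.

(* Lebesgue measure on R^n, as an iterated product; see [lebesgue_rV_box]. *)
Fixpoint lebesgue_rV n : {sigma_finite_measure set 'rV[R]_n -> \bar R} :=
  match n with
  | 0 => \d_(0 : 'rV[R]_0)
  | k.+1 => lebesgue_rVS (lebesgue_rV k)
  end.

Lemma lebesgue_rV_box n (A : 'I_n -> set R) : (forall i, measurable (A i)) ->
  lebesgue_rV n [set x | forall i, A i (x ord0 i)] =
  (\prod_(i < n) lebesgue_measure (A i))%E.
Proof.
elim: n A => [|n IHn] A mA.
  by rewrite big_ord0 /= diracE mem_set//= => -[].
rewrite big_ord_recl /= /lebesgue_rVS /pushforward.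
have -> : @rV_cons n @^-1` [set x | forall i, A i (x ord0 i)] =
    A ord0 `*` [set x : 'rV[R]_n | forall i, A (lift ord0 i) (x ord0 i)].
  apply/seteqP; split=> [[x v] /= H|[x v] /= [Hx Hv] i].
    split=> [|i]; first by have := H ord0; rewrite mxE unlift_none.
    by have := H (lift ord0 i); rewrite mxE liftK.
  by rewrite mxE; have [j ->|->] := unliftP ord0 i.
rewrite product_measure1E; [|exact: mA|].
  by congr (_ * _)%E; exact: (IHn (fun i => A (lift ord0 i))).
rewrite [X in measurable X](_ : _ = \bigcap_(i in [set: 'I_n])
      ((fun y : 'rV[R]_n => y ord0 i) @^-1` A (lift ord0 i))).
  apply: fin_bigcap_measurable; first exact: finite_finset.
  by move=> i _; rewrite -[X in measurable X]setTI; exact: measurable_coord.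
by apply/seteqP; split=> [y By i _|y By i]; [exact: By|exact: (By i I)].
Qed.

End lebesgue_measure_rV.

Section local_lens_depth.
Context (R : realType) (p : nat).

(* Euclidean norm: the library's norm on 'rV[R]_p is the sup norm. *)
Definition enorm (x : 'rV[R]_p) : R := Num.sqrt (\sum_(i < p) x ord0 i ^+ 2).

Definition eball (e : R) (x : 'rV[R]_p) : set 'rV[R]_p :=
  [set y | enorm (x - y) <= e].

Definition lens_set (tau : \bar R) (x : 'rV[R]_p) :
    set ('rV[R]_p * 'rV[R]_p) :=
  [set y | Num.max (enorm (x - y.1)) (enorm (x - y.2)) <= enorm (y.1 - y.2) /\
           ((enorm (y.1 - y.2))%:E <= tau)%E].

Definition LLD (P : probability 'rV[R]_p R) (x : 'rV[R]_p) (tau : \bar R) : R :=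
  \int[(P \x P)%E]_y \1_(lens_set tau x) y.

Definition Lambda1 : R :=
  fine ((lebesgue_rV R p \x lebesgue_rV R p)%E (lens_set 1 0)).

Definition tau_approx (P : probability 'rV[R]_p R) (tau : R) (x : 'rV[R]_p) : R :=
  (tau ^+ p * Num.sqrt Lambda1)^-1 * Num.sqrt (LLD P x tau%:E).

Definition is_density (P : probability 'rV[R]_p R) (f : 'rV[R]_p -> R) : Prop :=
  [/\ measurable_fun setT f,
      forall x, 0 <= f x &
      forall A, measurable A -> P A = (\int[lebesgue_rV R p]_(x in A) (f x)%:E)%E].

(* Supremum of |g| over A, taken in [0, +oo]: it is 0 when A is empty and +oo
   when g is unbounded on A. *)
Definition sup_abs (A : set 'rV[R]_p) (g : 'rV[R]_p -> R) : \bar R :=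
  Order.max 0%E (ereal_sup [set `|g x|%:E | x in A]).

End local_lens_depth.

(* Main.v *)
Require Import Defs.
From mathcomp Require Import all_boot all_order all_algebra.
From mathcomp Require Import all_classical all_reals all_analysis.
From mathcomp Require Import measurable_realfun ring lra.

(** The convergence follows from one deterministic estimate
    ([tau_approx_dist]): if the density oscillates by at most [d] around [x] on
    the Euclidean ball of radius [t], then the approximation at scale [t]
    differs from [f x] by at most [d].

    A pair belonging to the lens set of [x] at scale [t] has both points in
    that ball. On the ball, the probability is squeezed between [a] and [b]
    times Lebesgue measure, with [a = max 0 (f x - d)] and [b = f x + d]; hence
    by Tonelli ([le_product_measure_sqr]) the local lens depth is squeezed
    between [a ^ 2] and [b ^ 2] times the Lebesgue measure of the lens set.
    Invariance of Lebesgue measure under translations and its homogeneity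
    under dilations ([lebesgue_rV_scaling]) show that this last measure is
    [(t ^ p) ^ 2 * Lambda1] ([lens_set_measure]), with [0 < Lambda1 < +oo]
    ([lens_set_gt0], [lens_set_finite]). Taking square roots and dividing by
    [t ^ p * sqrt Lambda1] leaves [a <= f_t x <= b].

    The three statements then only differ by how the oscillation of [f] on
    small balls is made uniform: uniform continuity gives it on the whole
    space, compactness (through near-coverings) on a compact set, and
    continuity at [x] on a neighbourhood of [x]. *)

Import Order.TTheory GRing.Theory Num.Theory.
Import numFieldNormedType.Exports.

Local Open Scope classical_set_scope.
Local Open Scope ring_scope.

Set Implicit Arguments.
Unset Strict Implicit.

(** * Comparing and rescaling product measures *)

(** The two factors are exchanged one at a time, each exchange being an
    inequality between measures of sections; Tonelli allows the second factor
    to be treated by vertical sections and the first one by horizontal ones.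
    This avoids identifying a density of the product measure. *)
Lemma le_product_measure_sqr d (T : measurableType d) (R : realType)
    (mu nu : {sigma_finite_measure set T -> \bar R}) (a b : R)
    (B : set T) (A : set (T * T)) :
  0 <= a -> 0 <= b -> measurable A -> A `<=` B `*` B ->
  (forall C, measurable C -> C `<=` B -> (a%:E * mu C <= b%:E * nu C)%E) ->
  ((a ^+ 2)%:E * (mu \x mu) A <= (b ^+ 2)%:E * (nu \x nu) A)%E.
Proof.
move=> a0 b0 mA AB le_mu_nu; rewrite !expr2 !EFinM -!muleA.
apply: (@le_trans _ _ (a%:E * (b%:E * (mu \x nu) A))%E).
  (* The mixed product of mu and nu sits between the two squares. *)
  apply: lee_wpmul2l; first by rewrite lee_fin.
  rewrite /product_measure1 -!ge0_integralZl_EFin//=;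
    try exact: measurable_fun_xsection.
  apply: ge0_le_integral => //=.
  - by move=> x _; rewrite mule_ge0.
  - by apply: measurable_funeM; exact: measurable_fun_xsection.
  - by apply: measurable_funeM; exact: measurable_fun_xsection.
  move=> x _; apply: le_mu_nu; first exact: measurable_xsection.
  by move=> y /xsectionP /AB[].
rewrite muleCA; apply: lee_wpmul2l; first by rewrite lee_fin.
have tonelli (m1 m2 : {sigma_finite_measure set T -> \bar R}) :
    ((m1 \x m2) A = \int[m2]_y m1 (ysection A y))%E.
  apply: (@product_measure_unique _ _ _ _ _ m1 m2
    (product_measure2 m1 m2)) => // X Y mX mY.
  exact: product_measure2E.
rewrite !tonelli -!ge0_integralZl_EFin//=;
  try exact: measurable_fun_ysection.
apply: ge0_le_integral => //=.
- by move=> x _; rewrite mule_ge0.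
- by apply: measurable_funeM; exact: measurable_fun_ysection.
- by apply: measurable_funeM; exact: measurable_fun_ysection.
move=> x _; apply: le_mu_nu; first exact: measurable_ysection.
by move=> y /ysectionP /AB[].
Qed.

(** Taken without division by the constants, so that the scaling relation is
    preserved as it stands by products. Both sides are measures that agree on
    rectangles. *)
Lemma product_measure_scaling d1 d2 (T1 : measurableType d1)
    (T2 : measurableType d2) (R : realType)
    (m1 : {sigma_finite_measure set T1 -> \bar R})
    (m2 : {sigma_finite_measure set T2 -> \bar R})
    (phi1 : T1 -> T1) (phi2 : T2 -> T2) (c1 c2 : R) :
  0 <= c1 -> 0 <= c2 ->
  measurable_fun setT phi1 -> measurable_fun setT phi2 ->
  (forall A, measurable A -> (c1%:E * m1 (phi1 @^-1` A) = m1 A)%E) ->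
  (forall A, measurable A -> (c2%:E * m2 (phi2 @^-1` A) = m2 A)%E) ->
  forall A, measurable A ->
    ((c1 * c2)%:E * (m1 \x m2) ((fun y => (phi1 y.1, phi2 y.2)) @^-1` A) =
     (m1 \x m2) A)%E.
Proof.
move=> c10 c20 mphi1 mphi2 scale1 scale2 A mA.
have mphi : measurable_fun setT (fun y => (phi1 y.1, phi2 y.2)).
  by apply: measurable_fun_pair; apply: measurableT_comp.
pose c := NngNum (mulr_ge0 c10 c20).
apply/esym/(@product_measure_unique _ _ _ _ _ m1 m2
  (mscale c (pushforward (m1 \x m2)%E (fun y => (phi1 y.1, phi2 y.2))))) => //.
move=> X Y mX mY.
rewrite [LHS](_ : _ = (c1 * c2)%:E *
  (m1 \x m2) ((phi1 @^-1` X) `*` (phi2 @^-1` Y)))%E//.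
have mpre1 : measurable (phi1 @^-1` X)
  by rewrite -[X in measurable X]setTI; exact: mphi1.
have mpre2 : measurable (phi2 @^-1` Y)
  by rewrite -[X in measurable X]setTI; exact: mphi2.
by rewrite product_measure1E// EFinM muleACA scale1// scale2.
Qed.

(** * Homotheties and Lebesgue measure *)

Lemma lebesgue_measure_scaling (R : realType) (x t : R) : 0 < t ->
  forall A : set (measurableTypeR R), measurable A ->
    (t%:E * @lebesgue_measure R ((fun y => x + t * y)%R @^-1` A) =
     @lebesgue_measure R A)%E.
Proof.
move=> t0 A mA; have t0' := ltW t0.
have mphi : measurable_fun [set: measurableTypeR R]
    (fun y : measurableTypeR R => (x + t * y : measurableTypeR R)).
  by apply: measurable_funD => //; apply: measurable_funM.
pose c := NngNum t0'.
apply/esym/(@lebesgue_measure_unique _ (mscale c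
  (pushforward (@lebesgue_measure R)
    (fun y : measurableTypeR R => (x + t * y : measurableTypeR R))))) => //.
move=> _ [[a b]] _ <-; rewrite [RHS](_ : _ = t%:E *
  @lebesgue_measure R ((fun y => x + t * y)%R @^-1` `]a, b]%classic))%E//.
rewrite [X in (_ = _ * lebesgue_measure X)%E](_ : _ =
  `](a - x) / t, (b - x) / t]%classic); last first.
  apply/seteqP; split=> y /=; rewrite !in_itv/= ltr_pdivrMr// ler_pdivlMr//;
    move=> /andP[? ?]; apply/andP; split; lra.
rewrite !lebesgue_measure_itv/= !lte_fin ltr_pM2r ?invr_gt0// ltrBlDr subrK.
case: ifP => ab; last by rewrite mule0.
by rewrite -!EFinB -EFinM; congr EFin; field; rewrite gt_eqF.
Qed.

Lemma measurable_rV_affine (R : realType) n (x : 'rV[R]_n) (t : R) :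
  measurable_fun [set: 'rV[R]_n] (fun y : 'rV[R]_n => x + t *: y).
Proof.
apply/measurable_fun_coordP => i.
rewrite [X in measurable_fun _ X](_ : _ =
  fun y : 'rV[R]_n => x ord0 i + t * y ord0 i); last first.
  by apply/funext => y; rewrite !mxE.
by apply: measurable_funD => //; apply: measurable_funM => //;
  exact: measurable_coord.
Qed.

(** Induction on the dimension: a homothety of [R^n.+1] acts as a product map
    once the first coordinate is split off, and the measure is by construction
    the corresponding product. *)
Lemma lebesgue_rV_scaling (R : realType) n (x : 'rV[R]_n) (t : R) : 0 < t ->
  forall A : set 'rV[R]_n, measurable A ->
  ((t ^+ n)%:E * lebesgue_rV R n ((fun y => x + t *: y)%R @^-1` A) =
   lebesgue_rV R n A)%E.
Proof.
move=> t0; elim: n x => [|n IHn] x A mA.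
  rewrite expr0 mul1e; congr (lebesgue_rV R 0 _).
  by apply/seteqP; split=> y /=; rewrite (thinmx0 (x + _)) (thinmx0 y).
pose xh := x ord0 ord0; pose xt : 'rV[R]_n := \row_j x ord0 (lift ord0 j).
have mA' : measurable (@rV_cons R n @^-1` A).
  by rewrite -[X in measurable X]setTI; exact: measurable_rV_cons.
have mh : measurable_fun [set: measurableTypeR R]
    (fun y : measurableTypeR R => (xh + t * y : measurableTypeR R)).
  by apply: measurable_funD => //; apply: measurable_funM.
rewrite exprS /= /lebesgue_rVS /pushforward.
rewrite -[RHS](product_measure_scaling (ltW t0) (exprn_ge0 n (ltW t0))
  mh (measurable_rV_affine xt t)
  (lebesgue_measure_scaling xh t0) (IHn xt))//.
congr (_ * (_ \x _) _)%E; apply/seteqP.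
have E yv : x + t *: @rV_cons R n yv =
    rV_cons (xh + t * yv.1, xt + t *: yv.2).
  apply/rowP => i; rewrite !mxE.
  by have [j ->|->] := unliftP ord0 i; rewrite ?mxE.
by split=> yv /=; rewrite E.
Qed.

(** * Geometry of the lens sets *)

Lemma enormN (R : realType) n (x : 'rV[R]_n) : enorm (- x) = enorm x.
Proof. by congr Num.sqrt; apply: eq_bigr => i _; rewrite !mxE sqrrN. Qed.

Lemma enormZ (R : realType) n (t : R) (x : 'rV[R]_n) : 0 <= t ->
  enorm (t *: x) = t * enorm x.
Proof.
move=> t0; rewrite /enorm.
under eq_bigr do rewrite mxE exprMn.
by rewrite -mulr_sumr sqrtrM ?sqr_ge0// sqrtr_sqr ger0_norm.
Qed.

Lemma le_enorm (R : realType) n (x y : 'rV[R]_n) :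
  (forall i, `|x ord0 i| <= `|y ord0 i|) -> enorm x <= enorm y.
Proof.
move=> xy; apply: ler_wsqrtr; apply: ler_sum => i _.
rewrite -[leLHS]real_normK ?num_real// -[leRHS]real_normK ?num_real//.
by rewrite lerXn2r ?nnegrE.
Qed.

Lemma coord_le_enorm (R : realType) n (x : 'rV[R]_n) i :
  `|x ord0 i| <= enorm x.
Proof.
rewrite -sqrtr_sqr; apply: ler_wsqrtr.
by rewrite (bigD1 i)//= lerDl sumr_ge0// => j _; exact: sqr_ge0.
Qed.

Lemma measurable_enorm d (T : measurableType d) (R : realType) n
    (g : T -> 'rV[R]_n) :
  measurable_fun setT g -> measurable_fun setT (fun y => enorm (g y)).
Proof.
move=> /measurable_fun_coordP mg.
apply: (measurableT_comp (f := @Num.sqrt R)).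
  exact: (continuous_measurable_fun (@sqrt_continuous R)).
by apply: measurable_sum => i; exact: measurable_funX.
Qed.

Lemma measurable_rVB d (T : measurableType d) (R : realType) n
    (g h : T -> 'rV[R]_n) :
  measurable_fun setT g -> measurable_fun setT h ->
  measurable_fun setT (fun y => g y - h y).
Proof.
move=> /measurable_fun_coordP mg /measurable_fun_coordP mh.
apply/measurable_fun_coordP => i.
rewrite [X in measurable_fun _ X](_ : _ =
  fun y => g y ord0 i - h y ord0 i); last by apply/funext => y; rewrite !mxE.
exact: measurable_funB.
Qed.

Lemma measurable_lens_set (R : realType) n (t : R) (x : 'rV[R]_n) :
  measurable (lens_set t%:E x).
Proof.
have m1 : measurable_fun setT (fst : 'rV[R]_n * 'rV[R]_n -> _) by [].
have m2 : measurable_fun setT (snd : 'rV[R]_n * 'rV[R]_n -> _) by [].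
rewrite (_ : lens_set _ _ =
    [set y | Num.max (enorm (x - y.1)) (enorm (x - y.2)) <=
             enorm (y.1 - y.2)] `&`
    [set y | enorm (y.1 - y.2) <= t]); last by apply/seteqP; split.
have m12 :
    measurable_fun setT (fun y : 'rV[R]_n * 'rV[R]_n => enorm (y.1 - y.2)).
  by apply: measurable_enorm; exact: measurable_rVB.
apply: measurableI; rewrite -[X in measurable X]setTI;
  apply: measurable_fun_le => //.
apply: measurable_maxr; apply: measurable_enorm; exact: measurable_rVB.
Qed.

Lemma lens_set_sub (R : realType) n (t : R) (x : 'rV[R]_n) :
  lens_set t%:E x `<=` eball t x `*` eball t x.
Proof.
by move=> y []; rewrite ge_max lee_fin => /andP[h1 h2] h; split => /=;
  apply: le_trans h.
Qed.

Lemma lens_set_scaling (R : realType) n (t : R) (x : 'rV[R]_n) : 0 < t ->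
  (fun y => (x + t *: y.1, x + t *: y.2)) @^-1` lens_set t%:E x =
  lens_set 1 (0 : 'rV[R]_n).
Proof.
move=> t0; rewrite /lens_set /preimage/=; apply/funext => -[y1 y2] /=.
have centerE u : x - (x + t *: u) = - (t *: u) by rewrite opprD addNKr.
have diffE : x + t *: y1 - (x + t *: y2) = t *: (y1 - y2).
  by rewrite opprD addrACA subrr add0r scalerBr.
rewrite !centerE diffE !sub0r !enormN !(enormZ _ (ltW t0)).
rewrite -maxr_pMr ?(ltW t0)// ler_pM2l//.
by rewrite !lee_fin ger_pMr.
Qed.

(** The homothety with centre [x] and ratio [t], applied to both points of a
    pair, carries the unit lens set of the origin onto the one of [x] at
    scale [t]. *)
Lemma lens_set_measure (R : realType) n (t : R) (x : 'rV[R]_n) : 0 < t ->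
  ((lebesgue_rV R n \x lebesgue_rV R n) (lens_set t%:E x) =
   ((t ^+ n) ^+ 2)%:E *
   (lebesgue_rV R n \x lebesgue_rV R n) (lens_set 1 0%R))%E.
Proof.
move=> t0; have tn0 := exprn_ge0 n (ltW t0).
rewrite -(lens_set_scaling x t0) expr2; apply/esym.
have mphi := measurable_rV_affine x t.
have scale := lebesgue_rV_scaling x t0.
apply: (product_measure_scaling tn0 tn0 mphi mphi scale scale).
exact: measurable_lens_set.
Qed.

(** * The constant Lambda1 is positive and finite *)

Definition rV_cube {R : realType} (n : nat) (a b : R) : set 'rV[R]_n :=
  [set x | forall i, `[a, b]%classic (x ord0 i)].
Arguments rV_cube {R} n a b.

Lemma measurable_rV_cube (R : realType) n (a b : R) :
  measurable (rV_cube n a b).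
Proof.
rewrite [X in measurable X](_ : _ = \bigcap_(i in [set: 'I_n])
    ((fun y : 'rV[R]_n => y ord0 i) @^-1` `[a, b]%classic)); last first.
  by apply/seteqP; split=> [y By i _|y By i]; [exact: By|exact: (By i I)].
apply: fin_bigcap_measurable; first exact: finite_finset.
move=> i _; rewrite -[X in measurable X]setTI; exact: measurable_coord.
Qed.

Lemma lebesgue_rV_cube (R : realType) n (a b : R) : a <= b ->
  lebesgue_rV R n (rV_cube n a b) = ((b - a) ^+ n)%:E.
Proof.
move=> ab; rewrite (@lebesgue_rV_box _ _ (fun=> `[a, b]%classic))//.
rewrite (eq_bigr (fun=> (b - a)%:E)) => [|i _].
  elim: n => [|n IHn]; first by rewrite big_ord0.
  by rewrite big_ord_recl IHn exprS EFinM.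
by rewrite lebesgue_measure_itv/= lte_fin lt_neqAle ab andbT;
  case: eqVneq => //= <-; rewrite subrr.
Qed.

Lemma lebesgue_rV_cubeX (R : realType) n (a b c d : R) : a <= b -> c <= d ->
  ((lebesgue_rV R n \x lebesgue_rV R n) (rV_cube n a b `*` rV_cube n c d) =
   ((b - a) ^+ n * (d - c) ^+ n)%:E)%E.
Proof.
move=> ab cd; rewrite product_measure1E; try exact: measurable_rV_cube.
by rewrite EFinM; exact: congr2 (lebesgue_rV_cube n ab) (lebesgue_rV_cube n cd).
Qed.

Lemma lens_set_finite (R : realType) n :
  ((lebesgue_rV R n \x lebesgue_rV R n) (lens_set 1 0%R) < +oo)%E.
Proof.
pose Q : set 'rV[R]_n := rV_cube n (-1) 1.
have mQ : measurable Q by exact: measurable_rV_cube.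
apply: (@le_lt_trans _ _ ((lebesgue_rV R n \x lebesgue_rV R n) (Q `*` Q)))%E.
  apply: le_measure; rewrite ?inE.
  - exact: (measurable_lens_set 1).
  - exact: measurableX.
  have eQ y : eball 1 0 y -> Q y.
    rewrite /eball/= sub0r enormN => y1 i /=.
    rewrite in_itv/= -ler_norml.
    by apply: le_trans y1; exact: coord_le_enorm.
  by move=> y /(lens_set_sub (t := 1))[y1 y2]; split; exact: eQ.
by rewrite lebesgue_rV_cubeX ?ltry//; lra.
Qed.

(** If the coordinates of [y1] are nonnegative and those of [y2] nonpositive,
    then neither is farther from the origin than they are from each other. So
    the unit lens set contains a product of two small cubes lying in opposite
    orthants. *)
Lemma lens_set_gt0 (R : realType) n :
  (0 < (lebesgue_rV R n \x lebesgue_rV R n) (lens_set 1 0%R))%E.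
Proof.
(* Side chosen so that the coordinates of [y1 - y2] are at most
   [1 / n.+1], which bounds the norm by 1 and also makes sense for [n = 0]. *)
pose r : R := (2 * n.+1%:R)^-1.
have r0 : 0 < r by rewrite invr_gt0 mulr_gt0.
pose Q1 : set 'rV[R]_n := rV_cube n 0 r.
pose Q2 : set 'rV[R]_n := rV_cube n (- r) 0.
have mQ1 : measurable Q1 by exact: measurable_rV_cube.
have mQ2 : measurable Q2 by exact: measurable_rV_cube.
apply: (@lt_le_trans _ _ ((lebesgue_rV R n \x lebesgue_rV R n) (Q1 `*` Q2)))%E.
  rewrite lebesgue_rV_cubeX ?oppr_le0 ?(ltW r0)// subr0 sub0r opprK.
  by rewrite lte_fin mulr_gt0// exprn_gt0.
apply: le_measure; rewrite ?inE.
- exact: measurableX.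
- exact: (measurable_lens_set 1).
move=> [y1 y2] [/= y1Q y2Q].
have y1i i : 0 <= y1 ord0 i <= r by have := y1Q i; rewrite /= in_itv.
have y2i i : - r <= y2 ord0 i <= 0 by have := y2Q i; rewrite /= in_itv.
split=> /=.
  rewrite !sub0r !enormN ge_max; apply/andP; split; apply: le_enorm => i;
    rewrite !mxE (ger0_norm (x := y1 _ _ - _)); move: (y1i i) (y2i i);
    rewrite ?ler_norml => /andP[? ?] /andP[? ?]; try (apply/andP; split); lra.
rewrite lee_fin -sqrtr1; apply: ler_wsqrtr.
apply: (@le_trans _ _ (\sum_(i < n) n.+1%:R^-1)).
  apply: ler_sum => i _; rewrite !mxE.
  apply: (@le_trans _ _ (n.+1%:R^-1 ^+ 2)).
    have rE : n.+1%:R^-1 = 2 * r.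
      by rewrite /r invfM mulrA divff ?mul1r// pnatr_eq0.
    rewrite rE; move: (y1i i) (y2i i) => /andP[? ?] /andP[? ?].
    by rewrite lerXn2r ?nnegrE//; lra.
  by rewrite expr2 ger_pMr ?invr_gt0// invf_le1// ler1n.
rewrite sumr_const card_ord -[X in X <= _]mulr_natr mulrC ler_pdivrMr//.
by rewrite mul1r ler_nat.
Qed.

(** * From oscillation of the density to error of the approximation *)

Lemma LLDE (R : realType) p (P : probability 'rV[R]_p R) (x : 'rV[R]_p)
    (t : R) :
  LLD P x t%:E = fine ((P \x P)%E (lens_set t%:E x)).
Proof.
rewrite /LLD /Rintegral integral_indic ?setIT//.
exact: measurable_lens_set.
Qed.

Lemma Lambda1_gt0 (R : realType) p : 0 < Lambda1 R p.
Proof. by rewrite fine_gt0// lens_set_gt0 lens_set_finite. Qed.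

Lemma lens_set_Lambda1 (R : realType) p (t : R) (x : 'rV[R]_p) : 0 < t ->
  ((lebesgue_rV R p \x lebesgue_rV R p) (lens_set t%:E x) =
   ((t ^+ p) ^+ 2 * Lambda1 R p)%:E)%E.
Proof.
move=> t0; rewrite lens_set_measure// [in RHS]EFinM /Lambda1 fineK//.
by rewrite ge0_fin_numE ?measure_ge0// lens_set_finite.
Qed.

Lemma density_measure_bounds (R : realType) p (P : probability 'rV[R]_p R)
    (f : 'rV[R]_p -> R) (a b : R) (B : set 'rV[R]_p) :
  is_density P f -> 0 <= a -> 0 <= b -> (forall y, B y -> a <= f y <= b) ->
  forall C, measurable C -> C `<=` B ->
    (a%:E * lebesgue_rV R p C <= P C)%E /\
    (P C <= b%:E * lebesgue_rV R p C)%E.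
Proof.
move=> [mf f0 Pf] a0 b0 fB C mC CB; rewrite Pf// -!integral_cst//.
have mfC : measurable_fun C (EFin \o f).
  by apply/measurable_EFinP; exact: measurable_funS mf.
split; apply: ge0_le_integral => //= y Cy; rewrite lee_fin //;
  by have /andP[] := fB _ (CB _ Cy).
Qed.

(** The heart of the proof: the approximation at scale [t] never leaves the
    range of values [f x - d, f x + d] of the density on the ball of radius
    [t]. Both points of a pair in the lens set lie in that ball, so the depth is
    between [a ^ 2] and [b ^ 2] times the Lebesgue measure of the lens set,
    which is exactly the square of the denominator in the approximation. *)
Lemma tau_approx_dist (R : realType) p (P : probability 'rV[R]_p R)
    (f : 'rV[R]_p -> R) (x : 'rV[R]_p) (t d : R) :
  is_density P f -> 0 < t -> 0 <= d ->
  (forall y, eball t x y -> `|f x - f y| <= d) ->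
  `|tau_approx P t x - f x| <= d.
Proof.
move=> Pf t0 d0 osc; have [_ f0 _] := Pf.
(* The lower bound is truncated at 0 so that it can be squared; the density
   being nonnegative, it remains a lower bound. *)
pose a := Num.max 0 (f x - d); pose b := f x + d.
have a0 : 0 <= a by rewrite le_max lexx.
have b0 : 0 <= b by rewrite addr_ge0.
have fB y : eball t x y -> a <= f y <= b.
  move=> /osc; rewrite ler_norml => /andP[h1 h2].
  by rewrite ge_max f0 /b /=; apply/andP; split; lra.
have bounds := density_measure_bounds Pf a0 b0 fB.
have mL := measurable_lens_set t x.
have LB := @lens_set_sub R p t x.
pose m := lebesgue_rV R p.
have lo : ((a ^+ 2)%:E * (m \x m) (lens_set t%:E x) <=
    (1 ^+ 2)%:E * (P \x P) (lens_set t%:E x))%E.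
  apply: (@le_product_measure_sqr _ _ _ m P) mL LB _ => // C mC CB.
  by rewrite mul1e; have [] := bounds C mC CB.
have hi : ((1 ^+ 2)%:E * (P \x P) (lens_set t%:E x) <=
    (b ^+ 2)%:E * (m \x m) (lens_set t%:E x))%E.
  apply: (@le_product_measure_sqr _ _ _ P m) mL LB _ => // C mC CB.
  by rewrite mul1e; have [] := bounds C mC CB.
have tp0 : 0 < t ^+ p by rewrite exprn_gt0.
have L0 := Lambda1_gt0 R p.
have Pfin : (P \x P)%E (lens_set t%:E x) = (LLD P x t%:E)%:E.
  rewrite LLDE fineK// ge0_fin_numE ?measure_ge0//.
  apply: le_lt_trans (ltry (b ^+ 2 * ((t ^+ p) ^+ 2 * Lambda1 R p))).
  by move: hi; rewrite expr1n mul1e lens_set_Lambda1// -EFinM.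
move: lo hi.
rewrite expr1n mul1e Pfin lens_set_Lambda1// -!EFinM !lee_fin => lo hi.
have sqrtE c : 0 <= c -> Num.sqrt (c ^+ 2 * ((t ^+ p) ^+ 2 * Lambda1 R p)) =
    c * (t ^+ p * Num.sqrt (Lambda1 R p)).
  move=> c0; rewrite (sqrtrM _ (sqr_ge0 c)) (sqrtrM _ (sqr_ge0 (t ^+ p))).
  by rewrite !sqrtr_sqr !ger0_norm// ltW.
have D0 : 0 < t ^+ p * Num.sqrt (Lambda1 R p) by rewrite mulr_gt0 ?sqrtr_gt0.
have /ler_wsqrtr := hi; rewrite sqrtE// => {}hi.
have /ler_wsqrtr := lo; rewrite sqrtE// => {}lo.
rewrite /tau_approx ler_distl mulrC ler_pdivlMr// ler_pdivrMr// hi andbT.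
apply: le_trans lo; rewrite ler_pM2r//.
by rewrite le_max lexx orbT.
Qed.

(** * Uniform convergence *)

Lemma sup_abs_cvg0 (R : realType) p (I : Type) (F : set_system I)
    (FF : Filter F) (A : I -> set 'rV[R]_p) (g : I -> 'rV[R]_p -> R) :
  (forall d, 0 < d -> \forall i \near F, forall x, A i x -> `|g i x| <= d) ->
  sup_abs (A i) (g i) @[i --> F] --> 0%E.
Proof.
move=> small.
have sup_ge0 i : (0 <= sup_abs (A i) (g i))%E by rewrite /sup_abs le_max lexx.
have near_le d : 0 < d -> \forall i \near F, (sup_abs (A i) (g i) <= d%:E)%E.
  move=> d0; near=> i; rewrite /sup_abs ge_max lee_fin ltW//=.
  apply: ub_ereal_sup => _ [x Ax <-]; rewrite lee_fin.
  by move: x Ax; near: i; exact: small.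
apply/fine_cvgP; split.
  near=> i; rewrite ge0_fin_numE//.
  by apply: le_lt_trans (ltry 1); near: i; exact: near_le.
apply/cvgr0Pnorm_le => d d0; near=> i.
have /= sle : (sup_abs (A i) (g i) <= d%:E)%E by near: i; exact: near_le.
rewrite /= ger0_norm ?fine_ge0// -lee_fin fineK// ge0_fin_numE//.
exact: le_lt_trans sle (ltry d).
Unshelve. all: by end_near. Qed.

(** Links the Euclidean balls of the lens sets to the sup-norm balls that
    generate the uniform structure. *)
Lemma eball_ball (R : realType) p (t e : R) (x : 'rV[R]_p) : 0 < e -> t < e ->
  eball t x `<=` ball x e.
Proof.
move=> e0 te y xyt; split=> // i j; rewrite (ord1 i) /ball/=.
have := coord_le_enorm (x - y) j; rewrite !mxE => h.
exact: le_lt_trans h (le_lt_trans xyt te).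
Qed.

(** The control of [f] around every [y] close to [x], and not only around [x],
    is what near-coverings of compact sets require; the points [z] are thus
    free to leave the compact set. *)
Lemma continuous_osc (R : realType) p (f : 'rV[R]_p -> R) (x : 'rV[R]_p)
    (d : R) :
  {for x, continuous f} -> 0 < d ->
  exists2 r, 0 < r & forall y z, ball x r y -> ball y r z ->
    `|f x - f y| <= d /\ `|f y - f z| <= d.
Proof.
move=> /cvgrPdist_le fx d0.
have /nbhs_ballP[r /= r0 rP] := fx (d / 2) (divr_gt0 d0 (ltr0Sn R 1)).
exists (r / 2); first by rewrite divr_gt0.
move=> y z xy yz.
have /rP/= fxy : ball x r y by apply: le_ball xy; lra.
have /rP/= fxz : ball x r z by rewrite [r]splitr; exact: ball_triangle xy yz.
split; first lra.
by apply: le_trans (ler_distD (f x) _ _) _; rewrite distrC; lra.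
Qed.

Unset Implicit Arguments.
Set Strict Implicit.

Theorem theorem2p2 (R : realType) (p : nat) (hp : (1 <= p)%N)
    (P : probability 'rV[R]_p R) (f : 'rV[R]_p -> R)
    (Pac : P `<< lebesgue_rV R p) (Pf : is_density P f) :
  (unif_continuous f -> bounded_fun f ->
     sup_abs setT (fun x => tau_approx P tau x - f x) @[tau --> 0^'+] --> 0%E)
  /\
  (continuous f ->
     (forall K : set 'rV[R]_p, compact K ->
        sup_abs K (fun x => tau_approx P tau x - f x) @[tau --> 0^'+] --> 0%E)
     /\
     (forall x : 'rV[R]_p,
        sup_abs (eball te.2 x) (fun y => tau_approx P te.1 y - f x)
          @[te --> filter_prod (0 : R)^'+ (0 : R)^'+] --> 0%E)).
Proof.
split=> [ucf _|cf].
  apply: (@sup_abs_cvg0 _ _ _ _ _ (fun=> setT)) => d d0.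
  have : entourage [set xy : R * R | `|xy.1 - xy.2| < d].
    by rewrite -entourage_ballE; exists d.
  move=> /ucf; rewrite -entourage_ballE => -[e /= e0 eP].
  near=> t => x _; apply: tau_approx_dist => //; first exact: ltW.
  move=> y /(@eball_ball _ _ _ e _) xy; apply/ltW/(eP (x, y))/xy => //.
have small_pos (r : R) : 0 < r -> \forall t \near (0 : R)^'+, 0 < t < r.
  move=> r0; near=> t; apply/andP; split; near: t.
    exact: nbhs_right_gt.
  exact: nbhs_right_lt.
split.
  move=> K /compact_near_coveringP Kcov.
  apply: (@sup_abs_cvg0 _ _ _ _ _ (fun=> K)) => d d0.
  apply: Kcov => x Kx.
  have [r r0 rP] := continuous_osc (cf x) d0.
  exists (ball x r, [set t | 0 < t < r]).
    by split; [exact: nbhsx_ballx | exact: small_pos].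
  move=> [y t] /= [xy /andP[t0 tr]]; apply: tau_approx_dist => //.
    exact: ltW.
  by move=> z /(eball_ball r0 tr) yz; have [] := rP y z xy yz.
move=> x; apply: (@sup_abs_cvg0 _ _ _ _ _ (fun te => eball te.2 x)
  (fun te y => tau_approx P te.1 y - f x)) => d d0.
have [r r0 rP] := continuous_osc (cf x) (divr_gt0 d0 (ltr0Sn R 1)).
exists ([set t | 0 < t < r], [set e | e < r]).
  split; [exact: small_pos | exact: nbhs_right_lt].
move=> [t e] /= [/andP[t0 tr] er] y /(eball_ball r0 er) xy.
rewrite [d]splitr -(subrK (f y) (tau_approx P t y)) -addrA.
apply: le_trans (ler_normD _ _) _; apply: lerD.
  apply: tau_approx_dist => //; first by rewrite ltW// divr_gt0.
  by move=> z /(eball_ball r0 tr) yz; have [] := rP y z xy yz.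
by rewrite distrC; have [] := rP y y xy (ballxx _ r0).
Unshelve. all: by end_near.
Qed.
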